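(* Let $(X,d,\mu,\mathcal{E},\mathcal{F})$ be a Dirichlet space satisfying the standing assumptions (A1)–(A3), (HK), (BE) stated in the context, and let $0<\delta<1$. Let $1\le p<\infty$ and assume $d_H>\delta d_W$. There is $C>0$ such that for every $f\in\mathbf{B}^{p,1/p}(X)$, $$\|f\|_{L^q(X,\mu)}\le C\left(\int_X\int_X\frac{|f(x)-f(y)|^p}{d(x,y)^{d_H+\delta d_W}}\,d\mu(y)\,d\mu(x)\right)^{1/p},$$ where $q=\frac{p\,d_H}{d_H-\delta d_W}$.
   Context: Setting. $(X,d,\mu)$ is a locally compact metric measure space, $\mu$ a Radon measure supported on $X$, and $(\mathcal{E},\mathcal{F})$ is a Dirichlet form on $L^2(X,\mu)$ with heat semigroup $\{P_t\}_{t>0}$ and generator $L$. Write $B(x,r)=\{y: d(x,y)<r\}$. For $\lambda>0$, $1\le p<\infty$, $KS^{\lambda,p}(X)$ is the set of $f\in L^p(X,\mu)$ with $\limsup_{r\to0^+}\int_X\int_{B(x,r)}\frac{|f(x)-f(y)|^p}{r^{\lambda p}\mu(B(x,r))}d\mu(y)d\mu(x)<\infty$. Standing assumptions. (A1) Every ball $B(x,r)$ has compact closure. (A2) There are $c_1,c_2,d_H>0$ with $c_1r^{d_H}\le\mu(B(x,r))\le c_2r^{d_H}$ for all $x\in X$, $r\ge0$. (A3) $(\mathcal{E},\mathcal{F})$ is regular and strongly local. (HK) $\{P_t\}$ has a continuous heat kernel $p_t(x,y)$ and there are $c_3,c_4,c_5,c_6\in(0,\infty)$, $d_W\in[2,\infty)$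 with $c_5t^{-d_H/d_W}\exp(-c_6(d(x,y)^{d_W}/t)^{1/(d_W-1)})\le p_t(x,y)\le c_3t^{-d_H/d_W}\exp(-c_4(d(x,y)^{d_W}/t)^{1/(d_W-1)})$ for $\mu\times\mu$-a.e. $(x,y)$ and every $t>0$. (BE) There is $C>0$ such that $|P_tg(x)-P_tg(y)|\le C\frac{d(x,y)^\kappa}{t^{\kappa/d_W}}\|g\|_{L^\infty(X,\mu)}$ for all $t>0$, $g\in L^\infty(X,\mu)$, $x,y\in X$, where $0<\kappa<d_W$ is defined by $d_W-\kappa=\sup\{\lambda>0: KS^{\lambda,1}(X)\text{ contains non-constant functions}\}$. Subordinated semigroup. For fixed $0<\delta<1$ let $\eta^{(\delta)}_t\ge0$ be the continuous function with $\int_0^\infty\eta^{(\delta)}_t(s)e^{-s\lambda}ds=e^{-t\lambda^\delta}$ for $\lambda>0$. The semigroup with generator given by the fractional Laplacian $(-L)^\delta$ is $P^{(\delta)}_tf=\int_0^\infty\eta^{(\delta)}_t(s)P_sf\,ds$, with heat kernel $p^{(\delta)}_t(x,y)=\int_0^\infty\eta^{(\delta)}_t(s)p_s(x,y)ds$. Besov classes. For $p\ge1$, $\alpha\ge0$: $\|f\|_{p,\alpha}=\sup_{t>0}t^{-\alpha}\left(\int_X\int_X|f(x)-f(y)|^pp^{(\delta)}_t(x,y)d\mu(x)d\mu(y)\right)^{1/p}$ and $\mathbf{B}^{p,\alpha}(X)=\{f\in L^p(X,\mu):\|f\|_{p,\alpha}<\infty\}$. *)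

(* Defs.v *)
(* Developed over MathComp-Analysis. *)
From HB Require Import structures.
From mathcomp Require Import all_boot all_order all_algebra.
From mathcomp Require Import all_classical all_reals all_analysis.

Set Implicit Arguments.
Unset Strict Implicit.
Unset Printing Implicit Defensive.

Import Order.TTheory GRing.Theory Num.Theory.
Import numFieldNormedType.Exports.

Local Open Scope classical_set_scope.
Local Open Scope ring_scope.

HB.mixin Record Metric_isBorel (d : measure_display) (R : realType) T
    & Metric R T & Measurable d T := {
  borel_measurableE : @measurable d T = <<s [set U : set T | open U] >>
}.

#[short(type="borelMetricType")]
HB.structure Definition BorelMetric (d : measure_display) (R : realType) :=
  {T of Metric R T & Measurable d T & Metric_isBorel d R T}.

Section MetricMeasure.
Context {d : measure_display} {R : realType} {X : borelMetricType d R}.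
Implicit Types (mu : {measure set X -> \bar R}) (f g h u v : X -> R).

Definition radon_measure mu :=
  [/\ (forall K : set X, compact K -> (mu K < +oo)%E),
      (forall A : set X, measurable A ->
         mu A = ereal_inf [set mu U | U in [set U | open U /\ A `<=` U]])
    & (forall U : set X, open U ->
         mu U = ereal_sup [set mu K | K in [set K | compact K /\ K `<=` U]])].

Definition full_support mu :=
  forall U : set X, open U -> U !=set0 -> (0 < mu U)%E.

Definition balls_precompact :=
  forall (x : X) (r : R), compact (closure (ball x r)).

Definition ahlfors_regular mu (dH : R) :=
  exists c1 c2 : R, [/\ 0 < c1, 0 < c2 &
    forall (x : X) (r : R), 0 <= r ->
      ((c1 * r `^ dH)%:E <= mu (ball x r) <= (c2 * r `^ dH)%:E)%E].

(** Elements of L^p(X, mu) are represented by Borel functions in [Lfun mu p];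
    everything below is stated so as to be insensitive to the choice of the
    representative. *)

Definition dotL2 mu f g : R := \int[mu]_x (f x * g x).

Definition normL2 mu f : \bar R := 'N[mu]_2%:E[EFin \o f].

Definition energy1 mu (E : (X -> R) -> (X -> R) -> R) f : R :=
  E f f + dotL2 mu f f.

Record dirichlet_form mu (E : (X -> R) -> (X -> R) -> R)
    (F : set (X -> R)) : Prop := {
  df_sub : forall f, F f -> f \in Lfun mu 2%:E ;
  df_ae : forall f g, F f -> g \in Lfun mu 2%:E -> f = g %[ae mu] ->
    F g /\ forall h, F h -> E f h = E g h ;
  df_lin : forall (a : R) f g, F f -> F g -> F (a \*: f + g) ;
  df_dense : forall f (e : R), f \in Lfun mu 2%:E -> 0 < e ->
    exists2 g, F g & (normL2 mu (f \- g)%R < e%:E)%E ;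
  df_sym : forall f g, F f -> F g -> E f g = E g f ;
  df_bilin : forall (a : R) f g h, F f -> F g -> F h ->
    E (a \*: f + g) h = a * E f h + E g h ;
  df_ge0 : forall f, F f -> 0 <= E f f ;
  df_closed : forall u_ : nat -> X -> R, (forall n, F (u_ n)) ->
    (forall e : R, 0 < e ->
       \forall m & n \near \oo, energy1 mu E (u_ m \- u_ n) < e) ->
    exists2 f, F f & energy1 mu E (u_ n \- f) @[n --> \oo] --> 0 ;
  df_markov : forall f, F f ->
    let g := fun x => Num.min (Num.max (f x) 0) 1 in
    F g /\ E g g <= E f f
}.

Definition compactly_supported_continuous f :=
  continuous f /\ compact (closure [set x | f x != 0]).

Definition regular_form mu (E : (X -> R) -> (X -> R) -> R)
    (F : set (X -> R)) :=
  (forall f (e : R), F f -> 0 < e -> exists g,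
     [/\ F g, compactly_supported_continuous g & energy1 mu E (f \- g) < e]) /\
  (forall f (e : R), compactly_supported_continuous f -> 0 < e -> exists g,
     [/\ F g, compactly_supported_continuous g &
         forall x, `|f x - g x| < e]).

(** The support of the measure |f| mu. *)
Definition ae_support mu f : set X :=
  [set x | forall U : set X, open U -> U x ->
     ~ mu.-negligible (U `&` [set y | f y != 0])].

Definition strongly_local mu (E : (X -> R) -> (X -> R) -> R)
    (F : set (X -> R)) :=
  forall u v, F u -> F v ->
    compact (ae_support mu u) -> compact (ae_support mu v) ->
    (exists (U : set X) (c : R), [/\ open U, ae_support mu u `<=` U &
       \forall x \ae mu, U x -> v x = c]) ->
    E u v = 0.

(** The graph of the nonpositive self-adjoint operator L of the form:
    E(f, h) = - <L f, h> for all h in F. *)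
Definition form_generator mu (E : (X -> R) -> (X -> R) -> R)
    (F : set (X -> R)) f g :=
  [/\ F f, g \in Lfun mu 2%:E & forall h, F h -> E f h = - dotL2 mu g h].

(** The graph of the infinitesimal generator of (P_t) on L^2. *)
Definition semigroup_generator mu (P : R -> (X -> R) -> X -> R) f g :=
  [/\ f \in Lfun mu 2%:E, g \in Lfun mu 2%:E &
    normL2 mu (fun x => t^-1 * (P t f x - f x) - g x) @[t --> 0^'+] --> 0%E].

(** P_t = e^{tL}: by Hille-Yosida, a strongly continuous contraction semigroup
    is determined by its generator. *)
Record heat_semigroup mu (E : (X -> R) -> (X -> R) -> R)
    (F : set (X -> R)) (P : R -> (X -> R) -> X -> R) : Prop := {
  hs_L2 : forall t f, 0 < t -> f \in Lfun mu 2%:E -> P t f \in Lfun mu 2%:E ;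
  hs_lin : forall t (a : R) f g, 0 < t ->
    f \in Lfun mu 2%:E -> g \in Lfun mu 2%:E ->
    P t (a \*: f + g) = a \*: P t f + P t g %[ae mu] ;
  hs_contraction : forall t f, 0 < t -> f \in Lfun mu 2%:E ->
    (normL2 mu (P t f) <= normL2 mu f)%E ;
  hs_semigroup : forall s t f, 0 < s -> 0 < t -> f \in Lfun mu 2%:E ->
    P (s + t) f = P s (P t f) %[ae mu] ;
  hs_continuous : forall f, f \in Lfun mu 2%:E ->
    normL2 mu (P t f \- f) @[t --> 0^'+] --> 0%E ;
  hs_generator : forall f g,
    semigroup_generator mu P f g <-> form_generator mu E F f g
}.

Definition continuous_heat_kernel mu (P : R -> (X -> R) -> X -> R)
    (p : R -> X -> X -> R) :=
  forall t, 0 < t ->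
    continuous (fun z : X * X => p t z.1 z.2) /\
    forall f, f \in Lfun mu 2%:E ->
      P t f = (fun x => \int[mu]_y (p t x y * f y)) %[ae mu].

Definition sub_gaussian (dH dW c : R) (t : R) (x y : X) : R :=
  t `^ (- dH / dW) *
  expR (- c * (mdist x y `^ dW / t) `^ (1 / (dW - 1))).

Definition sub_gaussian_estimates mu (p : R -> X -> X -> R) (dH dW : R) :=
  exists c3 c4 c5 c6 : R, [/\ 0 < c3 /\ 0 < c4, 0 < c5 /\ 0 < c6 &
    forall t, 0 < t -> \forall z \ae (mu \x mu)%E,
      c5 * sub_gaussian dH dW c6 t z.1 z.2 <= p t z.1 z.2 <=
      c3 * sub_gaussian dH dW c4 t z.1 z.2].

Definition korevaar_schoen mu (lambda p : R) : set (X -> R) :=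
  [set f | f \in Lfun mu p%:E /\
    (limf_esup (fun r : R =>
       \int[mu]_x \int[mu]_(y in ball x r)
         (`|f x - f y| `^ p /
            (r `^ (lambda * p) * fine (mu (ball x r))))%:E) 0^'+ < +oo)%E].

Definition nonconstant mu f := ~ exists c : R, \forall x \ae mu, f x = c.

Definition KS_critical_exponent mu (p : R) : \bar R :=
  ereal_sup [set lambda%:E | lambda in [set lambda : R | 0 < lambda /\
    exists f, korevaar_schoen mu lambda p f /\ nonconstant mu f]].

(** P_t acts on L^oo through the heat kernel, which gives the pointwise values
    of P_t g. *)
Definition weak_bakry_emery mu (p : R -> X -> X -> R) (dW kappa : R) :=
  exists2 C : R, 0 < C & forall t g (x y : X), 0 < t -> g \in Lfun mu +oo%E ->
    (`| \int[mu]_z (p t x z * g z) - \int[mu]_z (p t y z * g z) |%:E <=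
     (C * (mdist x y `^ kappa / t `^ (kappa / dW)))%:E
       * 'N[mu]_+oo[EFin \o g])%E.

Definition stable_subordinator (delta : R) (eta : R -> R -> R) :=
  forall t, 0 < t ->
    [/\ (forall s, 0 < s -> 0 <= eta t s),
        {in `]0, +oo[, continuous (eta t)}
      & forall lambda : R, 0 < lambda ->
        (\int[lebesgue_measure]_(s in `]0%R, +oo[)
           (eta t s * expR (- (s * lambda)))%:E)%E =
        (expR (- (t * lambda `^ delta)))%:E].

Definition subordinated_kernel (eta : R -> R -> R) (p : R -> X -> X -> R)
    (t : R) (x y : X) : \bar R :=
  \int[lebesgue_measure]_(s in `]0%R, +oo[) (eta t s * p s x y)%:E.

Definition besov_seminorm mu (k : R -> X -> X -> \bar R) (p alpha : R) f
    : \bar R :=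
  ereal_sup [set ((t `^ (- alpha))%:E *
    (\int[mu]_y \int[mu]_x ((`|f x - f y| `^ p)%:E * k t x y)) `^ p^-1)%E
    | t in [set t : R | 0 < t]].

Definition besov_class mu (k : R -> X -> X -> \bar R) (p alpha : R)
    : set (X -> R) :=
  [set f | f \in Lfun mu p%:E /\ (besov_seminorm mu k p alpha f < +oo)%E].

End MetricMeasure.

Arguments balls_precompact {d R} X.

(* Main.v *)
Require Import Defs.
From HB Require Import structures.
From mathcomp Require Import all_boot all_order all_algebra.
From mathcomp Require Import all_classical all_reals all_analysis.

From mathcomp Require Import measurable_realfun ring.

(** The inequality is a fractional Sobolev inequality, and it follows from
    the lower volume bound [c1 r^dH <= mu (B(x,r))].  Put [s = delta dW],
    [theta = s / dH] and [q = p dH / (dH - s)], so that [q (1 - theta) = p].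

    Let [g >= 0] with [I = int g^q] finite, and let [a = g x > 0].  By
    Chebyshev, the set [{g >= a/2}] has measure at most [2^q I / a^q].  Choose
    the radius [r] so that the volume bound gives [B(x,r)] at least twice that
    measure: then at least half of the guaranteed volume of the ball consists
    of points [y] with [g y < a/2], where [|g x - g y| >= a/2].  Therefore
    [int |g x - g y|^p / d(x,y)^(dH+s) dy] is at least a constant times
    [a^p r^(-s)], and since [r^dH] is proportional to [I / a^q] this equals a
    constant times [I^(-theta) a^q]: this is [gagliardo_pointwise].

    Integrating in [x] gives [k I^(1-theta) <= S(g)], where [S] is the double
    integral ([fractional_sobolev_finite]).  This is the claim for [g], because
    [I^((1-theta)/p)] is the [L^q] norm of [g].  The argument needs [I] to be
    finite, so it is applied to [g = min(|f|, n)]: such a truncation of a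
    function in [L^p] lies in [L^q] since [q > p], truncating does not increase
    [S], and [n] tends to infinity by monotone convergence
    ([fractional_sobolev]).

    The integral of a nonnegative function is a supremum over simple functions,
    hence monotone for arbitrary integrands.  So the double integral is treated
    as a lower integral, bounded from below by integrals of functions of [x]
    that are visibly measurable. *)

Set Implicit Arguments.
Unset Strict Implicit.
Unset Printing Implicit Defensive.

Import Order.TTheory GRing.Theory Num.Theory.
Import numFieldNormedType.Exports.

Local Open Scope classical_set_scope.
Local Open Scope ring_scope.


Section FractionalSobolev.
Context {d : measure_display} {R : realType}.

(** * Powers, integrals and measurability *)

Lemma powR_div (a b r : R) : 0 <= a -> 0 <= b ->
  (a / b) `^ r = a `^ r / b `^ r.
Proof.
move=> a0 b0; rewrite powRM ?invr_ge0//; congr (_ * _).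
by rewrite -powR_inv1// powRAC powR_inv1 ?powR_ge0.
Qed.

(** Every simple function below [f] is also below [g].  In the double integral
    the inner integral is an arbitrary nonnegative function of the outer
    variable, which is why monotonicity is wanted in this form. *)
Lemma ge0_le_integral_nonmeasurable (T : measurableType d)
    (mu : {measure set T -> \bar R}) (f g : T -> \bar R) :
  (forall x, 0 <= f x)%E -> (forall x, f x <= g x)%E ->
  (\int[mu]_x f x <= \int[mu]_x g x)%E.
Proof.
move=> f0 fg; have g0 x : (0 <= g x)%E by exact: le_trans (f0 x) (fg x).
rewrite !ge0_integralTE//; apply: ereal_sup_le => _ [h hf <-].
by exists h => // x; exact: le_trans (hf x) (fg x).
Qed.

Lemma measurable_metric_ball (X : borelMetricType d R) (x : X) (r : R) :
  measurable (ball x r).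
Proof.
rewrite borel_measurableE; apply: sub_gen_smallest => /=.
rewrite openE => y; rewrite ballEmdist /= => xy.
apply/nbhs_ballP; exists (r - mdist x y); first by rewrite /= subr_gt0.
move=> z; rewrite !ballEmdist/= ltrBrDl; apply: le_lt_trans.
exact: metric_triangle.
Qed.

Lemma measurable_superlevel (T : measurableType d) (g : T -> R) (a : R) :
  measurable_fun [set: T] g -> measurable [set x | a <= g x].
Proof.
move=> mg; rewrite -[X in measurable X]setTI.
have := mg measurableT `[a, +oo[%classic (measurable_itv _).
rewrite (_ : g @^-1` _ = [set x | a <= g x])//.
by apply/seteqP; split => x /=; rewrite in_itv/= andbT.
Qed.

Lemma powR_chebyshev (T : measurableType d) (mu : {measure set T -> \bar R})
    (g : T -> R) (q a I : R) :
  measurable_fun [set: T] g -> (forall x, 0 <= g x) -> 0 <= q -> 0 < a ->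
  (\int[mu]_x (g x `^ q)%:E)%E = I%:E ->
  (mu [set x | (a <= g x)%R] <= (I / a `^ q)%:E)%E.
Proof.
move=> mg g0 q0 a0 gI.
have mA := measurable_superlevel a mg.
have aq0 : 0 < a `^ q by exact: powR_gt0.
rewrite EFinM lee_pdivlMr// muleC -(integral_cst mu mA (a `^ q)%:E) -gI.
rewrite integral_mkcond; apply: ge0_le_integral_nonmeasurable => x.
  by rewrite patchE; case: ifP => // _; rewrite lee_fin ltW.
rewrite patchE; case: ifPn => [|_]; rewrite lee_fin ?powR_ge0//.
by rewrite inE /= => agx; apply: ge0_ler_powR => //; rewrite nnegrE// ltW.
Qed.


(** * The inequality for functions of finite L^q norm *)

Context {X : borelMetricType d R} (mu : {measure set X -> \bar R}).
Context (dH s c1 p q : R).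
Context (dH_gt0 : 0 < dH) (s_gt0 : 0 < s) (s_lt_dH : s < dH).
Context (c1_gt0 : 0 < c1) (p_gt0 : 0 < p) (qE : q = p * dH / (dH - s)).
Context (ball_ge : forall (x : X) (r : R), 0 <= r ->
  ((c1 * r `^ dH)%:E <= mu (ball x r))%E).

Let theta := s / dH.
Let c := 2 * 2 `^ q / c1.
Let k := c1 / 2 / (2 `^ p * c `^ theta).

Let dHs_gt0 : 0 < dH - s. Proof. by rewrite subr_gt0. Qed.

Let q_gt0 : 0 < q.
Proof. by rewrite qE divr_gt0// mulr_gt0. Qed.

Let theta_gt0 : 0 < theta. Proof. by rewrite divr_gt0. Qed.

Let theta_lt1 : theta < 1. Proof. by rewrite ltr_pdivrMr// mul1r. Qed.

Let q_theta : q * (1 - theta) = p.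
Proof. by rewrite qE /theta; field; rewrite !gt_eqF. Qed.

Let c_gt0 : 0 < c. Proof. by rewrite divr_gt0// mulr_gt0// powR_gt0. Qed.

Let k_gt0 : 0 < k.
Proof. by rewrite !divr_gt0// mulr_gt0// powR_gt0. Qed.

Definition gagliardo_density (f : X -> R) (x y : X) : \bar R :=
  (`|f x - f y| `^ p / mdist x y `^ (dH + s))%:E.

Lemma gagliardo_density_ge0 f x y : (0 <= gagliardo_density f x y)%E.
Proof. by rewrite lee_fin mulr_ge0// ?invr_ge0 powR_ge0. Qed.

(** The ball around [x] is too large for [g] to stay above [g x / 2] on all of
    it, since that would exceed the mass [I]; the part where [g] drops below
    [g x / 2] contributes the lower bound. *)
Lemma gagliardo_pointwise (g : X -> R) (I : R) (x : X) :
  measurable_fun [set: X] g -> (forall y, 0 <= g y) ->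
  (\int[mu]_y (g y `^ q)%:E)%E = I%:E ->
  ((k / I `^ theta * g x `^ q)%:E <= \int[mu]_y gagliardo_density g x y)%E.
Proof.
move=> mg g0 gI.
have I0 : 0 <= I.
  by rewrite -lee_fin -gI integral_ge0// => y _; rewrite lee_fin powR_ge0.
have intD0 : (0 <= \int[mu]_y gagliardo_density g x y)%E.
  by apply: integral_ge0 => y _; exact: gagliardo_density_ge0.
have [gx0|gx0] := eqVneq (g x) 0.
  by rewrite gx0 powR0 ?mulr0// gt_eqF.
have {}gx0 : 0 < g x by rewrite lt_neqAle eq_sym gx0 g0.
have [->|In0] := eqVneq I 0.
  by rewrite powR0 ?gt_eqF// invr0 mulr0 mul0r.
have {In0}I_gt0 : 0 < I by rewrite lt_neqAle eq_sym In0 I0.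
set a := g x in gx0 *.
have aq0 : 0 < a `^ q by exact: powR_gt0.
(* [t] is the value of [r^dH] for which [c1 t / 2], half the guaranteed volume
   of the ball, is the Chebyshev bound for the measure of [g >= a / 2]. *)
pose t := c * (I / a `^ q).
have t0 : 0 < t by rewrite mulr_gt0// divr_gt0.
pose r := t `^ dH^-1.
have r0 : 0 < r by exact: powR_gt0.
have rdH : r `^ dH = t by rewrite -powRrM mulVf ?gt_eqF// powRr1// ltW.
have rs : r `^ s = t `^ theta by rewrite -powRrM mulrC.
pose L := [set y | a / 2 <= g y].
have mL : measurable L by exact: measurable_superlevel.
have mB : measurable (ball x r) by exact: measurable_metric_ball.
have mBL : measurable (ball x r `\` L) by exact: measurableD.
have muL : (mu L <= (c1 * t / 2)%:E)%E.
  have := powR_chebyshev mg g0 (ltW q_gt0) (divr_gt0 gx0 (@ltr0Sn _ 1)) gI.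
  rewrite powR_div//; last exact: g0.
  suff -> : I / (a `^ q / 2 `^ q) = c1 * t / 2 by [].
  by rewrite /t /c; field; rewrite !gt_eqF// powR_gt0.
have muBL : ((c1 * t / 2)%:E <= mu (ball x r `\` L))%E.
  have : ((c1 * t)%:E <= mu (ball x r `\` L) + (c1 * t / 2)%:E)%E.
    rewrite -rdH; apply: le_trans (ball_ge x (ltW r0)) _.
    rewrite rdH (measureDI mu mB mL) leeD2l//; apply: le_trans muL.
    by apply: le_measure; rewrite ?inE//; exact: measurableI.
  rewrite -leeBlDr// -EFinB; apply: le_trans; rewrite lee_fin.
  by rewrite {2}[c1 * t]splitr addrK.
(* Lower bound of the integrand at a point [y] of the ball outside [L]. *)
pose v := (a / 2) `^ p / r `^ (dH + s).
have v0 : 0 <= v by rewrite divr_ge0// powR_ge0.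
apply: (@le_trans _ _ (v%:E * mu (ball x r `\` L))%E); last first.
  rewrite -(integral_cst mu mBL v%:E) integral_mkcond.
  apply: ge0_le_integral_nonmeasurable => y; rewrite patchE; case: ifPn => //;
    last by move=> _; exact: gagliardo_density_ge0.
  move=> /[!inE] -[]; rewrite ballEmdist/= => xyr /negP; rewrite -ltNge => gya.
  have axy : a / 2 <= `|g x - g y|.
    rewrite (le_trans _ (ler_norm _))// -/a {2}[a]splitr -addrA lerDl.
    by rewrite subr_ge0 ltW.
  have xy : 0 < mdist x y.
    rewrite mdist_gt0; apply/negP => /eqP xy; move: axy.
    by rewrite -xy subrr normr0 leNgt divr_gt0.
  rewrite lee_fin ler_pM// ?invr_ge0 ?powR_ge0//.
    by apply: ge0_ler_powR; rewrite ?nnegrE// ltW// divr_gt0.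
  rewrite lef_pV2 ?posrE ?powR_gt0//.
  by apply: ge0_ler_powR; rewrite ?nnegrE ?ltW ?addr_gt0.
apply: (@le_trans _ _ (v%:E * (c1 * t / 2)%:E)%E); last first.
  by rewrite lee_wpmul2l// lee_fin.
(* The exponents close up because [p + q theta = q]. *)
have aqE : a `^ q = a `^ p * (a `^ q) `^ theta.
  rewrite -powRrM -powRD; last by rewrite (gt_eqF gx0) implybT.
  by congr powR; rewrite -[in RHS]q_theta; ring.
have tE : t `^ theta = c `^ theta * (I `^ theta / (a `^ q) `^ theta).
  by rewrite powRM ?powR_div ?divr_ge0 ?powR_ge0 ?ltW.
rewrite -EFinM lee_fin /v powRD ?(gt_eqF r0) ?implybT// rdH rs tE.
rewrite (powR_div _ (ltW gx0))//.
rewrite [X in _ * X <= _]aqE le_eqVlt; apply/orP; left; apply/eqP.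
by rewrite /k; field; rewrite !gt_eqF// powR_gt0.
Qed.

Lemma fractional_sobolev_finite (g : X -> R) (I : R) :
  measurable_fun [set: X] g -> (forall y, 0 <= g y) ->
  (\int[mu]_y (g y `^ q)%:E)%E = I%:E ->
  ((k * I `^ (1 - theta))%:E <=
    \int[mu]_x \int[mu]_y gagliardo_density g x y)%E.
Proof.
move=> mg g0 gI.
have I0 : 0 <= I.
  by rewrite -lee_fin -gI integral_ge0// => y _; rewrite lee_fin powR_ge0.
have kI0 : 0 <= k / I `^ theta by rewrite divr_ge0 ?powR_ge0 ?ltW.
have -> : k * I `^ (1 - theta) = k / I `^ theta * I.
  have [->|In0] := eqVneq I 0; last by rewrite powRB ?In0 ?implybT// powRr1//; ring.
  by rewrite powR0 ?mulr0// subr_eq0 gt_eqF.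
rewrite EFinM -gI -ge0_integralZl_EFin//; last 2 first.
- by move=> x _; rewrite lee_fin powR_ge0.
- by apply/measurable_EFinP; apply: (measurableT_comp (measurable_powR _)).
apply: ge0_le_integral_nonmeasurable => x.
  by rewrite -EFinM lee_fin mulr_ge0// powR_ge0.
by rewrite -EFinM; exact: gagliardo_pointwise.
Qed.

(** * Removing the finiteness assumption by truncation *)

Lemma gagliardo_density_contraction (f : X -> R) (h : R -> R) x y :
  (forall a b, `|h a - h b| <= `|a - b|) ->
  (gagliardo_density (h \o f) x y <= gagliardo_density f x y)%E.
Proof.
move=> h_contr; rewrite lee_fin ler_wpM2r ?invr_ge0 ?powR_ge0//.
apply: ge0_ler_powR; rewrite ?nnegrE ?(ltW p_gt0)//; exact: h_contr.
Qed.

Definition trunc_norm (n a : R) := Num.min `|a| n.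

Lemma trunc_norm_contraction n a b : `|trunc_norm n a - trunc_norm n b| <= `|a - b|.
Proof.
apply: le_trans (ler_dist_dist a b); rewrite /trunc_norm.
wlog ab : a b / `|a| <= `|b|.
  by move=> H; case/orP: (le_total `|a| `|b|) => /H//; rewrite distrC [leRHS]distrC.
rewrite distrC [leRHS]distrC (ger0_norm (x := `|b| - `|a|)) ?subr_ge0//.
have [na|an] := leP n `|a|.
  by rewrite (min_r (le_trans na ab)) subrr normr0 subr_ge0.
have [nb|bn] := leP n `|b|; last by rewrite ger0_norm ?subr_ge0.
by rewrite ger0_norm ?subr_ge0 ?(ltW an)// lerD2r.
Qed.

Lemma trunc_norm_ge0 n a : 0 <= n -> 0 <= trunc_norm n a.
Proof. by move=> n0; rewrite le_min normr_ge0. Qed.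

Let p_lt_q : p < q.
Proof. by rewrite -q_theta gtr_pMr// ltrBlDr ltrDl. Qed.

(** Since [q > p], the factor [min(|f|, n)^(q - p)] is bounded, which leaves
    the integrable [|f|^p]. *)
Lemma trunc_norm_integrable (f : X -> R) (n : R) : 0 <= n ->
  measurable_fun [set: X] f -> (\int[mu]_x (`|f x| `^ p)%:E < +oo)%E ->
  (\int[mu]_x (trunc_norm n (f x) `^ q)%:E < +oo)%E.
Proof.
move=> n0 mf fp.
apply: (@le_lt_trans _ _
  (\int[mu]_x ((n `^ (q - p))%:E * (`|f x| `^ p)%:E))%E); last first.
  rewrite ge0_integralZl_EFin ?powR_ge0//; last first.
    apply/measurable_EFinP; apply: (measurableT_comp (measurable_powR _)).
    exact: measurableT_comp.
  by apply: lte_mul_pinfty => //; rewrite lee_fin powR_ge0.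
apply: ge0_le_integral_nonmeasurable => x; first by rewrite lee_fin powR_ge0.
have c0 := trunc_norm_ge0 (f x) n0.
rewrite -EFinM lee_fin -[q in leLHS](subrK p) [leLHS]powRD; last first.
  by rewrite addrNK (gt_eqF q_gt0).
rewrite ler_pM ?powR_ge0//; apply: ge0_ler_powR; rewrite ?nnegrE ?subr_ge0//.
- exact: ltW.
- by rewrite ge_min lexx orbT.
- exact: ltW.
- by rewrite ge_min lexx.
Qed.

Lemma trunc_norm_monotone_convergence (f : X -> R) (M : \bar R) :
  measurable_fun [set: X] f ->
  (forall n : nat, (\int[mu]_x (trunc_norm n%:R (f x) `^ q)%:E <= M)%E) ->
  (\int[mu]_x (`|f x| `^ q)%:E <= M)%E.
Proof.
move=> mf fM.
pose g' (n : nat) x := (trunc_norm n%:R (f x) `^ q)%:E.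
have mg' n : measurable_fun [set: X] (g' n).
  apply/measurable_EFinP; apply: (measurableT_comp (measurable_powR _)).
  apply: measurable_minr => //; exact: measurableT_comp.
have g'0 n x : setT x -> (0 <= g' n x)%E by rewrite lee_fin powR_ge0.
have nd_g' x : setT x -> nondecreasing_seq (g'^~ x).
  move=> _ m n mn; rewrite lee_fin ge0_ler_powR ?nnegrE ?trunc_norm_ge0 ?(ltW q_gt0)//.
  by rewrite /trunc_norm le_min ge_min lexx/= ge_min ler_nat mn orbT.
rewrite (eq_integral (fun x => limn (g'^~ x))); last first.
  move=> x _; apply/esym/lim_near_cst => //.
  exists (Num.truncn `|f x|).+1 => // n /= fn.
  rewrite /g' /trunc_norm min_l// (le_trans (ltW (truncnS_gt _)))// ler_nat.
  exact: fn.
have := cvg_monotone_convergence measurableT mg' g'0 nd_g'.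
move=> /(_ mu) cv; rewrite -(cvg_lim _ cv)//; apply: lime_le.
  by apply: cvgP cv.
exact: nearW.
Qed.

Lemma fractional_sobolev (f : X -> R) : f \in Lfun mu p%:E ->
  ('N[mu]_q%:E[EFin \o f] <= (k `^ (- p^-1))%:E *
     (\int[mu]_x \int[mu]_y gagliardo_density f x y) `^ p^-1)%E.
Proof.
move=> /andP[/[!inE] mf Nf].
have fp : (\int[mu]_x (`|f x| `^ p)%:E < +oo)%E.
  have := poweR_Lnorm mu (EFin \o f) (lt0r_neq0 p_gt0) => /= <-.
  exact: poweR_lty.
have S0 : (0 <= \int[mu]_x \int[mu]_y gagliardo_density f x y)%E.
  apply: integral_ge0 => x _; apply: integral_ge0 => y _.
  exact: gagliardo_density_ge0.
(* If the double integral is infinite, there is nothing to prove. *)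
case S_E : (\int[mu]_x \int[mu]_y gagliardo_density f x y)%E S0 => [S||]//; last first.
  move=> _; rewrite poweRyr ?invr_neq0 ?gt_eqF// gt0_muley ?leey//.
  by rewrite lte_fin powR_gt0.
rewrite lee_fin => S0.
have Sk0 : 0 <= S / k by rewrite divr_ge0// ltW.
have th0 : 0 < 1 - theta by rewrite subr_gt0.
(* [((1 - theta) q)^-1 = p^-1], so taking the power [q^-1] of this bound gives
   the claim. *)
suff fq : (\int[mu]_x (`|f x| `^ q)%:E <= ((S / k) `^ (1 - theta)^-1)%:E)%E.
  rewrite unlock /=; apply: le_trans.
    apply: gt0_ler_poweR fq; rewrite ?invr_ge0 ?(ltW q_gt0)//.
      by rewrite in_itv/= leey andbT integral_ge0// => x _; rewrite lee_fin powR_ge0.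
    by rewrite in_itv/= leey andbT lee_fin powR_ge0.
  rewrite !poweR_EFin -EFinM lee_fin -powRrM -invfM [_ * q]mulrC q_theta.
  by rewrite powR_div ?(ltW k_gt0)// powRN mulrC.
apply: trunc_norm_monotone_convergence => // n.
have n0 : 0 <= n%:R :> R by [].
have := trunc_norm_integrable n0 mf fp.
case I_E : (\int[mu]_x (trunc_norm n%:R (f x) `^ q)%:E)%E => [I||]// _;
  last by rewrite leNye.
have := @fractional_sobolev_finite (trunc_norm n%:R \o f) I _ _ I_E.
have I0 : 0 <= I.
  by rewrite -lee_fin -I_E integral_ge0// => y _; rewrite lee_fin powR_ge0.
move=> H.
have : ((k * I `^ (1 - theta))%:E <= S%:E)%E.
  rewrite -S_E; apply: le_trans (H _ _) _.
  - apply: measurable_minr => //; exact: measurableT_comp.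
  - by move=> y; exact: trunc_norm_ge0.
  apply: ge0_le_integral_nonmeasurable => x.
    by apply: integral_ge0 => y _; exact: gagliardo_density_ge0.
  apply: ge0_le_integral_nonmeasurable => y; first exact: gagliardo_density_ge0.
  by apply: gagliardo_density_contraction; exact: trunc_norm_contraction.
rewrite lee_fin mulrC -ler_pdivlMr// => IS.
have -> : I = (I `^ (1 - theta)) `^ (1 - theta)^-1.
  by rewrite -powRrM mulfV ?gt_eqF// powRr1.
by rewrite lee_fin ge0_ler_powR ?nnegrE ?powR_ge0 ?invr_ge0 ?(ltW th0).
Qed.

End FractionalSobolev.

Theorem theorem5p5 (R : realType) (d : measure_display)
  (X : borelMetricType d R) (mu : {measure set X -> \bar R})
  (E : (X -> R) -> (X -> R) -> R) (F : set (X -> R))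
  (P : R -> (X -> R) -> X -> R) (pt : R -> X -> X -> R)
  (dH dW kappa delta p : R) (eta : R -> R -> R)
  (X_locally_compact : locally_compact [set: X])
  (mu_radon : radon_measure mu) (mu_support : full_support mu)
  (E_dirichlet : dirichlet_form mu E F)
  (P_heat : heat_semigroup mu E F P)
  (A1 : balls_precompact X)
  (dH_gt0 : 0 < dH) (A2 : ahlfors_regular mu dH)
  (A3_regular : regular_form mu E F) (A3_local : strongly_local mu E F)
  (dW_ge2 : 2 <= dW)
  (pt_kernel : continuous_heat_kernel mu P pt)
  (HK : sub_gaussian_estimates mu pt dH dW)
  (kappa_gt0 : 0 < kappa) (kappa_lt : kappa < dW)
  (kappa_def : (dW - kappa)%:E = KS_critical_exponent mu 1)
  (BE : weak_bakry_emery mu pt dW kappa)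
  (delta_gt0 : 0 < delta) (delta_lt1 : delta < 1)
  (eta_def : stable_subordinator delta eta)
  (p_ge1 : 1 <= p) (dH_gt : delta * dW < dH) :
  let q := p * dH / (dH - delta * dW) in
  exists2 C : R, 0 < C &
    forall f, f \in besov_class mu (subordinated_kernel eta pt) p p^-1 ->
      ('N[mu]_q%:E[EFin \o f] <=
       C%:E * (\int[mu]_x \int[mu]_y
                 (`|f x - f y| `^ p /
                    mdist x y `^ (dH + delta * dW))%:E) `^ p^-1)%E.
Proof.
have [c1 [c2 [c1_gt0 _ ball_bounds]]] := A2.
move=> q.
have dW_gt0 : 0 < dW by exact: lt_le_trans dW_ge2.
have p_gt0 : 0 < p by exact: lt_le_trans p_ge1.
have s_gt0 : 0 < delta * dW by rewrite mulr_gt0.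
have ball_ge (x : X) (r : R) (r0 : 0 <= r) :
    ((c1 * r `^ dH)%:E <= mu (ball x r))%E by case/andP: (ball_bounds x r r0).
eexists; last first.
  move=> f /[!inE] -[fLp _].
  exact: (fractional_sobolev dH_gt0 s_gt0 dH_gt c1_gt0 p_gt0 erefl ball_ge fLp).
by rewrite powR_gt0// !divr_gt0// mulr_gt0// powR_gt0// divr_gt0// mulr_gt0// powR_gt0.
Qed.
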